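(* The variety $\mathbb{MG}_\sim$ has the finite embeddability property (FEP).
   Context: A Gödel algebra is a Heyting algebra $\langle A,\vee,\wedge,\to,0,1\rangle$ satisfying $(x\to y)\vee(y\to x)\approx 1$; put $\neg x:=x\to 0$. A De Morgan algebra is a bounded distributive lattice with a unary operation $\sim$ satisfying $\sim\sim x\approx x$ and $\sim(x\wedge y)\approx \sim x\vee\sim y$. A $G_\sim$-algebra $\langle \mathbf A,\sim\rangle$ is a Gödel algebra $\mathbf A$ with a unary operation $\sim$ that makes its bounded lattice reduct a De Morgan algebra and satisfies $\neg x\le\sim x$. $\mathbb{MG}_\sim$ is the variety of $MG_\sim$-algebras: algebras $\langle A,\vee,\wedge,\to,\sim,\exists,\forall,0,1\rangle$ such that $\langle \mathbf A,\sim\rangle$ is a $G_\sim$-algebra and: (M1) $\forall x\to x\approx 1$; (M2) $\forall(x\to\forall y)\approx\exists x\to\forall y$; (M3) $\forall(\forall x\to y)\approx\forall x\to\forall y$; (M4) $\forall(\exists x\vee y)\approx\exists x\vee\forall y$; (Q) $\forall x\approx\ \sim\exists\sim x$. A class $\mathcal K$ of algebras has the FEP if for every $\mathbf A\in\mathcal K$ and every finite subset $N\subseteq A$ there are a finite $\mathbf B\in\mathcal K$ and an injective map $\iota:N\to B$ such that for each basic operation $f$ (of arity $n$) and all $a_1,\dots,a_n\in N$ with $f^{\mathbf A}(a_1,\dots,a_n)\in N$ one has $\iota(f^{\mathbf A}(a_1,\dots,a_n))=f^{\mathbf B}(\iota(a_1),\dots,\iota(a_n))$. *)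

(* Defs.v *)
From mathcomp Require Import all_boot.
From mathcomp Require Import boolp classical_sets functions cardinality.

Set Implicit Arguments.
Unset Strict Implicit.
Unset Printing Implicit Defensive.

Local Open Scope classical_set_scope.

Record signature := Signature { op : Type; arity : op -> nat }.

Record algebra (S : signature) := Algebra {
  carrier :> Type;
  interp : forall f : op S, (arity f).-tuple carrier -> carrier }.

Arguments interp {S} A f : rename.

(* The coercion of N : set A to a type is the subtype of the elements of N; an
   operation has its value in N exactly when that value is \val b for some
   b : N. *)
Definition partial_embedding (S : signature) (A B : algebra S) (N : set A)
    (iota : N -> B) : Prop :=
  injective iota /\
  forall (f : op S) (a : (arity f).-tuple N) (b : N),
    interp A f (map_tuple \val a) = \val b ->
    iota b = interp B f (map_tuple iota a).

Definition FEP (S : signature) (K : algebra S -> Prop) : Prop :=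
  forall A : algebra S, K A ->
  forall N : set A, finite_set N ->
  exists B : algebra S,
    [/\ K B, finite_set [set: B]
      & exists iota : N -> B, partial_embedding iota].

Record is_bounded_lattice (T : Type) (join meet : T -> T -> T) (bot top : T) :
    Prop := IsBoundedLattice {
  joinA : associative join;
  joinC : commutative join;
  meetA : associative meet;
  meetC : commutative meet;
  join_meet_absorb : forall x y, join x (meet x y) = x;
  meet_join_absorb : forall x y, meet x (join x y) = x;
  join_bot : right_id bot join;
  meet_top : right_id top meet }.

Definition lattice_le (T : Type) (meet : T -> T -> T) (x y : T) : Prop :=
  meet x y = x.

Record is_heyting (T : Type) (join meet imp : T -> T -> T) (bot top : T) :
    Prop := IsHeyting {
  heyting_lattice : is_bounded_lattice join meet bot top;
  heyting_residuation : forall x y z,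
    lattice_le meet (meet x y) z <-> lattice_le meet x (imp y z) }.

Record is_godel (T : Type) (join meet imp : T -> T -> T) (bot top : T) :
    Prop := IsGodel {
  godel_heyting : is_heyting join meet imp bot top;
  godel_prelinearity : forall x y, join (imp x y) (imp y x) = top }.

Record is_de_morgan (T : Type) (join meet : T -> T -> T) (sim : T -> T)
    (bot top : T) : Prop := IsDeMorgan {
  de_morgan_lattice : is_bounded_lattice join meet bot top;
  de_morgan_distr : left_distributive meet join;
  de_morgan_involutive : involutive sim;
  de_morgan_meet : forall x y, sim (meet x y) = join (sim x) (sim y) }.

Record is_Gsim (T : Type) (join meet imp : T -> T -> T) (sim : T -> T)
    (bot top : T) : Prop := IsGsim {
  Gsim_godel : is_godel join meet imp bot top;
  Gsim_de_morgan : is_de_morgan join meet sim bot top;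
  Gsim_neg_le : forall x, lattice_le meet (imp x bot) (sim x) }.

Record is_MGsim (T : Type) (join meet imp : T -> T -> T) (sim ex all : T -> T)
    (bot top : T) : Prop := IsMGsim {
  MGsim_Gsim : is_Gsim join meet imp sim bot top;
  MGsim_M1 : forall x, imp (all x) x = top;
  MGsim_M2 : forall x y, all (imp x (all y)) = imp (ex x) (all y);
  MGsim_M3 : forall x y, all (imp (all x) y) = imp (all x) (all y);
  MGsim_M4 : forall x y, all (join (ex x) y) = join (ex x) (all y);
  MGsim_Q : forall x, all x = sim (ex (sim x)) }.

Inductive MG_op := Join | Meet | Imp | Sim | Exists | Forall | Bot | Top.

Definition MG_arity (f : MG_op) : nat :=
  match f with
  | Join | Meet | Imp => 2
  | Sim | Exists | Forall => 1
  | Bot | Top => 0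
  end.

Definition MG_signature : signature := Signature MG_arity.

Definition MGsim (A : algebra MG_signature) : Prop :=
  let op0 (f : 0.-tuple A -> A) := f [tuple] in
  let op1 (f : 1.-tuple A -> A) x := f [tuple x] in
  let op2 (f : 2.-tuple A -> A) x y := f [tuple x; y] in
  is_MGsim (op2 (interp A Join)) (op2 (interp A Meet)) (op2 (interp A Imp))
    (op1 (interp A Sim)) (op1 (interp A Exists)) (op1 (interp A Forall))
    (op0 (interp A Bot)) (op0 (interp A Top)).

(* Main.v *)
Require Import Defs.
From mathcomp Require Import all_boot.
From mathcomp Require Import boolp classical_sets functions cardinality.

(* Gsim-algebras are locally finite: for a finite set G containing 0 and 1 and
   closed under ~, Boolean elements of the form delta (g -> h) cut the algebra
   into finitely many components on each of which G is a chain, and the elements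
   that agree with some member of G on every component form a finite subuniverse.
   Given a finite N, let U be a finite Gsim-subuniverse containing N, and let C
   be the set of fixed points of the universal quantifier in U. Replacing the
   universal quantifier by "largest element of C below x", and the existential
   one by its dual, again gives an MGsim-algebra; the new quantifiers take the
   old values wherever these lie in U, and U is closed under all operations. *)

Set Implicit Arguments.
Unset Strict Implicit.
Unset Printing Implicit Defensive.

Local Open Scope classical_set_scope.

Record Gsim_subuniverse (T : Type) (join meet imp : T -> T -> T) (sim : T -> T)
    (bot top : T) (U : set T) : Prop := GsimSubuniverse {
  sub_bot : U bot;
  sub_top : U top;
  sub_join : forall x y, U x -> U y -> U (join x y);
  sub_meet : forall x y, U x -> U y -> U (meet x y);
  sub_imp : forall x y, U x -> U y -> U (imp x y);
  sub_sim : forall x, U x -> U (sim x) }.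

Declare Scope lat_scope.
Delimit Scope lat_scope with L.

(** * Order, residuation and De Morgan laws *)

Section GsimTheory.

Variables (T : Type) (join meet imp : T -> T -> T) (sim : T -> T) (bot top : T).
Hypothesis TG : is_Gsim join meet imp sim bot top.

Local Notation "x <= y" := (lattice_le meet x y) : lat_scope.
Local Notation "x `&` y" := (meet x y) : lat_scope.
Local Notation "x `|` y" := (join x y) : lat_scope.
Local Notation "x ==> y" := (imp x y) : lat_scope.
Local Notation "~` x" := (sim x) : lat_scope.
Local Notation "0" := bot : lat_scope.
Local Notation "1" := top : lat_scope.
Local Open Scope lat_scope.

Let TH := godel_heyting (Gsim_godel TG).
Let TL := heyting_lattice TH.
Let TDM := Gsim_de_morgan TG.

Lemma meetxx x : x `&` x = x.
Proof. by rewrite -{2}(join_meet_absorb TL x x) (meet_join_absorb TL). Qed.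

Lemma le_refl x : x <= x. Proof. exact: meetxx. Qed.
Hint Resolve le_refl : core.

Lemma le_anti x y : x <= y -> y <= x -> x = y.
Proof. by move=> xy yx; rewrite -xy (meetC TL) yx. Qed.

Lemma le_trans y x z : x <= y -> y <= z -> x <= z.
Proof. by move=> xy yz; rewrite /lattice_le -{1}xy -(meetA TL) yz xy. Qed.

Lemma leIl x y : x `&` y <= x.
Proof. by rewrite /lattice_le (meetC TL) (meetA TL) meetxx. Qed.

Lemma leIr x y : x `&` y <= y.
Proof. by rewrite /lattice_le -(meetA TL) meetxx. Qed.

Lemma lexI x y z : x <= y -> x <= z -> x <= y `&` z.
Proof. by rewrite /lattice_le => xy xz; rewrite (meetA TL) xy xz. Qed.

Lemma leI2 x y z t : x <= y -> z <= t -> x `&` z <= y `&` t.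
Proof.
by move=> xy zt; apply: lexI;
   [apply: le_trans _ xy; apply: leIl | apply: le_trans _ zt; apply: leIr].
Qed.

Lemma leUl x y : x <= x `|` y. Proof. exact: meet_join_absorb TL x y. Qed.

Lemma leUr x y : y <= x `|` y. Proof. by rewrite (joinC TL); apply: leUl. Qed.

Lemma le_join x y : x <= y -> x `|` y = y.
Proof.
by move=> xy; rewrite -{1}xy (joinC TL) (meetC TL) (join_meet_absorb TL).
Qed.

Lemma leUx x y z : x <= z -> y <= z -> x `|` y <= z.
Proof.
move=> xz yz; have <- : (x `|` y) `|` z = z; last exact: leUl.
by rewrite -(joinA TL) (le_join yz) (le_join xz).
Qed.

Lemma leU2 x y z t : x <= y -> z <= t -> x `|` z <= y `|` t.
Proof.
by move=> xy zt; apply: leUx;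
   [apply: le_trans xy _; apply: leUl | apply: le_trans zt _; apply: leUr].
Qed.

Lemma lex1 x : x <= 1. Proof. exact: meet_top TL x. Qed.

Lemma le0x x : 0 <= x.
Proof. by have := leUr x 0; rewrite (join_bot TL). Qed.
Hint Resolve lex1 le0x : core.

Lemma le1x x : 1 <= x -> x = 1. Proof. exact: le_anti. Qed.

Lemma lex0 x : x <= 0 -> x = 0. Proof. by move=> /le_anti; apply. Qed.

Lemma meetUl x y z : (x `|` y) `&` z = (x `&` z) `|` (y `&` z).
Proof. exact: (de_morgan_distr TDM). Qed.

Lemma meetUr x y z : z `&` (x `|` y) = (z `&` x) `|` (z `&` y).
Proof. by rewrite !(meetC TL z) meetUl. Qed.

Lemma meet_le_imp x y z : x `&` y <= z <-> x <= y ==> z.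
Proof. exact: heyting_residuation TH x y z. Qed.

Lemma imp_intro x y z : x `&` y <= z -> x <= y ==> z.
Proof. by move=> ?; apply/meet_le_imp. Qed.

Lemma imp_elim x y z : x <= y ==> z -> x `&` y <= z.
Proof. by move=> ?; apply/meet_le_imp. Qed.

Lemma mp x y : (x ==> y) `&` x <= y. Proof. exact/meet_le_imp. Qed.

Lemma impE1 x y : x ==> y = 1 <-> x <= y.
Proof.
split=> [e|xy]; last first.
  by apply: le1x; apply: imp_intro; rewrite (meetC TL) (meet_top TL).
by have := mp x y; rewrite e (meetC TL) (meet_top TL).
Qed.

Lemma prelinear x y : (x ==> y) `|` (y ==> x) = 1.
Proof. exact: (godel_prelinearity (Gsim_godel TG)). Qed.

Lemma cover_le e d x y : d `|` e = 1 -> x `&` d <= y -> x `&` e <= y -> x <= y.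
Proof.
by move=> de xd xe; rewrite -(meet_top TL x) -de meetUr; apply: leUx.
Qed.

Lemma simK x : ~` (~` x) = x. Proof. exact: de_morgan_involutive TDM x. Qed.

Lemma simI x y : ~` (x `&` y) = ~` x `|` ~` y.
Proof. exact: de_morgan_meet TDM x y. Qed.

Lemma simU x y : ~` (x `|` y) = ~` x `&` ~` y.
Proof. by rewrite -[RHS]simK simI !simK. Qed.

Lemma sim_le x y : x <= y -> ~` y <= ~` x.
Proof. by move=> <-; rewrite simI; apply: leUr. Qed.

Lemma sim0 : ~` 0 = 1.
Proof. by apply: le1x; rewrite -(simK 1); apply: sim_le. Qed.

Lemma sim1 : ~` 1 = 0. Proof. by rewrite -sim0 simK. Qed.

(** * Boolean elements and covers of 1 *)

(* The Baaz projection: on a chain, it sends [1] to [1] and the rest to [0]. *)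
Definition delta x := (~` x) ==> 0.

Definition boolean x := x `&` ~` x = 0.

Lemma delta_le x : delta x <= x.
Proof. by have := Gsim_neg_le TG (~` x); rewrite simK. Qed.

Lemma delta1 : delta 1 = 1.
Proof. by rewrite /delta sim1; apply/impE1. Qed.

(** Prelinearity for [x] and its negation: the first implication lies below the negation, the second
    below the double negation. *)
Lemma stone x : (x ==> 0) `|` ((x ==> 0) ==> 0) = 1.
Proof.
apply: le1x; rewrite -(prelinear x (x ==> 0)); apply: leU2; apply: imp_intro.
  by apply: le_trans _ (mp x 0); apply: lexI; [exact: mp | exact: leIr].
apply: le_trans _ (mp x 0); rewrite (meetC TL); apply: lexI; last first.
  by rewrite (meetC TL); apply: mp.
exact: leIl.
Qed.

(** Applying [sim] to the Stone identity d \/ d' = 1 gives ~d /\ ~d' = 0. So ~d' <= delta d <= d,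
    hence ~d <= d', while d /\ d' = 0. *)
Lemma delta_boolean x : boolean (delta x).
Proof.
set d := delta x; set d' := d ==> 0.
have /sim_le : 1 <= d `|` d' by rewrite stone.
rewrite simU sim1 (meetC TL) => /meet_le_imp/le_trans/(_ (delta_le d))/sim_le.
rewrite simK => dd'; apply: lex0; apply: le_trans _ (mp d 0).
by rewrite (meetC TL); apply: leI2.
Qed.

Lemma boolean1 : boolean 1.
Proof. by rewrite /boolean sim1; apply: lex0; apply: leIr. Qed.

Lemma booleanI x y : boolean x -> boolean y -> boolean (x `&` y).
Proof.
rewrite /boolean => bx yb; apply: lex0; rewrite simI meetUr; apply: leUx.
  by rewrite -bx; apply: leI2 => //; apply: leIl.
by rewrite -yb; apply: leI2 => //; apply: leIr.
Qed.

(** With u = ~x and v = ~y, prelinearity allows working below u -> v or v -> u. There the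
    pseudocomplement of u /\ v lies below that of u or of v, that is, below [delta x] or
    [delta y]. *)
Lemma delta_cover x y : x `|` y = 1 -> delta x `|` delta y = 1.
Proof.
move=> xy; apply: le1x; rewrite -delta1 -xy /delta simU.
set u := ~` x; set v := ~` y.
have aux (a b : T) : (((a `&` b) ==> 0) `&` (a ==> b)) <= (a ==> 0).
  apply: imp_intro; apply: le_trans _ (mp (a `&` b) 0).
  rewrite -(meetA TL); apply: leI2 => //; apply: lexI; last exact: mp.
  exact: leIr.
apply: (cover_le (prelinear u v)).
  by apply: le_trans (aux u v) _; apply: leUl.
by rewrite (meetC TL u); apply: le_trans (aux v u) _; apply: leUr.
Qed.

(** Prelinearity for u = x -> y and u -> y. One half contracts to u -> y. For the other, x <= u ->
    y, so (u -> y) -> u met with x lies below u, and then below y. *)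
Lemma imp_cover x y : (x ==> y) `|` ((x ==> y) ==> y) = 1.
Proof.
set u := x ==> y; apply: le1x; rewrite -(prelinear u (u ==> y)).
have cut : (u ==> y) ==> u <= u.
  apply: imp_intro; apply: le_trans _ (mp x y); apply: lexI; last exact: leIr.
  apply: le_trans _ (mp (u ==> y) u); apply: leI2 => //.
  by apply: imp_intro; rewrite (meetC TL); apply: mp.
apply: leUx; last by apply: le_trans cut _; apply: leUl.
apply: le_trans (leUr _ _); apply: imp_intro.
apply: le_trans _ (mp u y); apply: lexI; [exact: mp | exact: leIr].
Qed.

(** * Components and local finiteness *)

(* The component cut out by [e] orders [G] as a chain; the second clause says
   that [g ==> h] is [1] or [h] there. *)
Definition decides (e : T) (G : set T) := forall g h, G g -> G h ->
  (e <= g ==> h \/ e <= h ==> g) /\ (e <= g ==> h \/ e <= (g ==> h) ==> h).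

(** Meeting with [e] acts as the projection to the component of [e]; the witness [g] may change with
    [e]. *)
Definition locally_in (E G : set T) :=
  [set t | forall e, E e -> exists2 g, G g & e `&` t = e `&` g].

(** The component of an implication depends only on the components of its arguments, so implications
    can be computed locally. *)
Lemma meet_imp e x y : e `&` (x ==> y) = e `&` ((e `&` x) ==> (e `&` y)).
Proof.
apply: le_anti; apply: lexI; try exact: leIl.
  apply: imp_intro; apply: lexI.
    by apply: le_trans (leIr _ _) _; apply: leIl.
  apply: le_trans _ (mp x y); apply: leI2; exact: leIr.
apply: imp_intro.
apply: le_trans _ (leIr e y); apply: le_trans _ (mp (e `&` x) (e `&` y)).
rewrite (meetC TL e) -(meetA TL); apply: leI2 => //.
Qed.

(** On a component that decides [G], a join or meet of two members of [G] is one of the two, and an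
    implication g -> h is 1 or h. *)
Lemma locally_in_subuniverse (E G : set T) :
  (forall e, E e -> boolean e /\ decides e G) ->
  G 0 -> G 1 -> (forall g, G g -> G (~` g)) ->
  Gsim_subuniverse join meet imp sim bot top (locally_in E G).
Proof.
move=> EG G0 G1 Gsim.
have dec e g h : E e -> G g -> G h -> e `&` g <= h \/ e `&` h <= g.
  by move=> Ee Gg Gh; have [[]/meet_le_imp] := (EG e Ee).2 g h Gg Gh; auto.
split.
- by move=> e _; exists 0.
- by move=> e _; exists 1.
- move=> x y Ux Uy e Ee; have [g Gg xg] := Ux e Ee; have [h Gh yh] := Uy e Ee.
  rewrite meetUr xg yh; have [gh|hg] := dec e g h Ee Gg Gh.
    by exists h => //; apply: le_join; apply: lexI; [exact: leIl|].
  exists g => //; rewrite (joinC TL); apply: le_join; apply: lexI => //.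
  exact: leIl.
- move=> x y Ux Uy e Ee; have [g Gg xg] := Ux e Ee; have [h Gh yh] := Uy e Ee.
  have -> : e `&` (x `&` y) = (e `&` g) `&` (e `&` h).
    rewrite -xg -yh; apply: le_anti.
      by apply: lexI; apply: leI2 => //; [exact: leIl | exact: leIr].
    apply: lexI; last by apply: leI2; apply: leIr.
    by apply: le_trans (leIl _ _) _; apply: leIl.
  have [gh|hg] := dec e g h Ee Gg Gh.
    by exists g => //; apply: lexI => //; exact: leIl.
  by exists h => //; rewrite (meetC TL); apply: lexI => //; exact: leIl.
- move=> x y Ux Uy e Ee; have [g Gg xg] := Ux e Ee; have [h Gh yh] := Uy e Ee.
  rewrite meet_imp xg yh -meet_imp.
  have [_ [gh|gh]] := (EG e Ee).2 g h Gg Gh.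
    by exists 1 => //; rewrite (meet_top TL).
  exists h => //; apply: le_anti; apply: lexI; try exact: leIl.
    exact/meet_le_imp.
  by apply: le_trans (leIr _ _) _; apply: imp_intro; apply: leIl.
- move=> x Ux e Ee; have [g Gg xg] := Ux e Ee; exists (~` g); first exact: Gsim.
  (* As e /\ ~e = 0, one has e /\ ~(e /\ t) = e /\ ~t, so [sim] acts locally too. *)
  have /(congr1 (fun t => e `&` ~` t)) := xg.
  have [be _] := EG e Ee.
  have e0 t : 0 `|` t = t by rewrite (joinC TL) (join_bot TL).
  by rewrite !simI !meetUr be !e0.
Qed.

(** By separation an element is determined by the list of its components, and each entry ranges over
    the finite set of meets of one [e] with [G]. *)
Lemma locally_in_finite (E G : set T) : finite_set E -> finite_set G ->
  (forall t u, (forall e, E e -> e `&` t = e `&` u) -> t = u) ->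
  finite_set (locally_in E G).
Proof.
move=> /(@finite_seqP {classic T})[s ->] finG sep.
pose f t : seq T := [seq e `&` t | e <- s].
suff fin : finite_set (f @` locally_in [set` s] G).
  have inj : {in f @^-1` (f @` locally_in [set` s] G) &, injective f}.
    move=> t u _ _ /(@eq_in_map {classic T} {classic T}) tu; exact: sep.
  by apply: sub_finite_set (finite_preimage inj fin) => t Ut; exists t.
(* The tail of [s] need not separate elements, so the induction counts only lists. *)
rewrite {sep}/f; elim: s => [|e s IHs].
  by apply: sub_finite_set (finite_set1 [::]) => _ [t _ <-].
apply: sub_finite_set
  (finite_image2 (fun a l => a :: l) (finite_image (meet e) finG) IHs).
move=> _ [t Ut <-] /=.
have [g Gg etg] := Ut e (mem_head _ _).
exists (e `&` t); first by exists g.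
exists [seq e' `&` t | e' <- s] => //; exists t => // e' se'.
by apply: Ut; rewrite /= in_cons [e' \in s]se' orbT.
Qed.

(** Starting from the single component 1, each pair in [P] splits every [e] into its meets with the
    two halves. The pieces may overlap; what matters is that together they still separate
    elements. *)
Lemma common_refinement (P : set (T * T)) : finite_set P ->
  (forall p, P p -> [/\ boolean p.1, boolean p.2 & p.1 `|` p.2 = 1]) ->
  exists E : set T, [/\ finite_set E,
    forall e, E e -> boolean e /\ forall p, P p -> e <= p.1 \/ e <= p.2
    & forall t u, (forall e, E e -> e `&` t = e `&` u) -> t = u].
Proof.
move=> /(@finite_seqP {classic (T * T)})[s ->].
elim: s => [|p s IHs] bP.
  exists [set 1]; split; first exact: finite_set1.
    by move=> _ ->; split; [exact: boolean1|].
  by move=> t u /(_ 1 erefl); rewrite !(meetC TL 1) !(meet_top TL).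
have [bp1 bp2 cover] := bP p (mem_head _ _).
have [|E [finE bE sepE]] := IHs.
  by move=> q sq; apply: bP; rewrite /= in_cons [q \in s]sq orbT.
exists ((meet p.1 @` E) `|` (meet p.2 @` E))%classic; split.
- by rewrite finite_setU; split; apply: finite_image.
- move=> _ [] [e Ee <-]; have [be de] := bE e Ee;
    (split; first exact: booleanI) => q; rewrite /= in_cons => /orP[/eqP->|sq].
  + by left; apply: leIl.
  + by have [] := de q sq => h; [left|right]; apply: le_trans (leIr _ _) h.
  + by right; apply: leIl.
  + by have [] := de q sq => h; [left|right]; apply: le_trans (leIr _ _) h.
- move=> t u tu; apply: sepE => e Ee.
  rewrite -(meet_top TL e) -cover meetUr !meetUl !(meetC TL e).
  by congr join; apply: tu; [left|right]; exists e.
Qed.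

Lemma Gsim_locally_finite (X : set T) : finite_set X ->
  exists U : set T, [/\ finite_set U, X `<=` U
    & Gsim_subuniverse join meet imp sim bot top U].
Proof.
move=> finX.
pose G := ((X `|` sim @` X) `|` [set 0; 1])%classic.
have finG : finite_set G.
  rewrite !finite_setU; do ?split; rewrite ?finite_set1 //.
  exact: finite_image.
have G0 : G 0 by right; left.
have G1 : G 1 by right; right.
have Gsim g : G g -> G (~` g).
  move=> [[Xg|[x Xx <-]]|[->|->]].
  - by left; right; exists g.
  - by rewrite simK; left; left.
  - by rewrite sim0.
  - by rewrite sim1.
(* A [p1] pair settles which of g and h is the smaller, a [p2] pair whether g -> h is 1 or h.
   Applying [delta] makes the covers Boolean, and [delta_le] later recovers the plain
   inequalities. *)
pose p1 g h := (delta (g ==> h), delta (h ==> g)).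
pose p2 g h := (delta (g ==> h), delta ((g ==> h) ==> h)).
pose P := ([set p1 g h | g in G & h in G]
  `|` [set p2 g h | g in G & h in G])%classic.
have finP : finite_set P by rewrite finite_setU; split; apply: finite_image2.
have [|E [finE bE sepE]] := common_refinement finP.
  move=> _ [] [g Gg [h Gh <-]]; split; try exact: delta_boolean.
    by apply: delta_cover; apply: prelinear.
  by apply: delta_cover; apply: imp_cover.
exists (locally_in E G); split; first exact: locally_in_finite.
  by move=> x Xx e _; exists x => //; left; left.
apply: locally_in_subuniverse => // e Ee; have [be de] := bE e Ee.
split=> // g h Gg Gh; split.
  have [] : e <= delta (g ==> h) \/ e <= delta (h ==> g).
  - by apply: (de (p1 g h)); left; exists g => //; exists h.
  - by left; apply: le_trans _ (delta_le _).
  - by right; apply: le_trans _ (delta_le _).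
have [] : e <= delta (g ==> h) \/ e <= delta ((g ==> h) ==> h).
- by apply: (de (p2 g h)); right; exists g => //; exists h.
- by left; apply: le_trans _ (delta_le _).
- by right; apply: le_trans _ (delta_le _).
Qed.

End GsimTheory.

(** * Quantifiers as interior operators *)

Section Quantifiers.

Variables (T : Type) (join meet imp : T -> T -> T) (sim ex all : T -> T).
Variables (bot top : T).

Local Notation "x <= y" := (lattice_le meet x y) : lat_scope.
Local Open Scope lat_scope.

Definition is_interior (C : set T) (q : T -> T) := forall x,
  [/\ C (q x), q x <= x & forall c, C c -> c <= x -> c <= q x].

(** This is (M3) at x = y = 1, once 1 is written as all 1 -> 1. *)
Lemma all_top : is_MGsim join meet imp sim ex all bot top -> all top = top.
Proof.
move=> TM; have TG := MGsim_Gsim TM.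
rewrite -[in LHS](MGsim_M1 TM top) (MGsim_M3 TM).
exact/(impE1 TG)/(le_refl TG).
Qed.

(** Monotonicity and idempotence both come from (M3): if all c <= x, then all c -> all x = all (all
    c -> x) = all 1 = 1. *)
Lemma all_interior : is_MGsim join meet imp sim ex all bot top ->
  is_interior [set x | all x = x] all.
Proof.
move=> TM x; have TG := MGsim_Gsim TM.
have all_le y : all y <= y by apply/(impE1 TG); apply: MGsim_M1 TM y.
have all1 := all_top TM.
have all_max c : c <= x -> all c <= all x.
  move=> cx; apply/(impE1 TG); rewrite -(MGsim_M3 TM) -[RHS]all1; congr all.
  by apply/(impE1 TG); apply: le_trans TG _ _ _ (all_le c) cx.
split=> //= [|c Cc cx]; last by rewrite -Cc; apply: all_max.
apply: (le_anti TG) => //; apply/(impE1 TG).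
by rewrite -(MGsim_M3 TM) (impE1 TG _ _).2 //; apply: (le_refl TG).
Qed.

(** Fixed points of [all] are also fixed by [ex]. Hence (Q) handles [sim], (M4) joins and (M3)
    implications; meets follow by De Morgan. *)
Lemma fixed_subuniverse : is_MGsim join meet imp sim ex all bot top ->
  Gsim_subuniverse join meet imp sim bot top [set x | all x = x].
Proof.
move=> TM; have TG := MGsim_Gsim TM; have allI := all_interior TM.
have TL := heyting_lattice (godel_heyting (Gsim_godel TG)).
have all_le x : all x <= x by have [] := allI x.
have all_all x : all (all x) = all x by have [] := allI x.
have all1 := all_top TM.
have all0 : all bot = bot by exact: lex0 TG _ (all_le bot).
(* (M2) gives ex (all x) -> all x = all (all x -> all x) = 1; the converse inequality is all y <= y
   at y = ~ all x, read through (Q). *)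
have ex_all x : ex (all x) = all x.
  apply: (le_anti TG).
    apply/(impE1 TG); rewrite -(MGsim_M2 TM) (impE1 TG _ _).2 //.
    exact: le_refl TG _.
  have := all_le (sim (all x)); rewrite (MGsim_Q TM) (simK TG) => /(sim_le TG).
  by rewrite !(simK TG).
have fix_sim x : all x = x -> all (sim x) = sim x.
  by move=> fx; rewrite (MGsim_Q TM) (simK TG) -{1}fx ex_all fx.
have fix_join x y : all x = x -> all y = y -> all (join x y) = join x y.
  by move=> fx fy; rewrite -{1}fx -(ex_all x) (MGsim_M4 TM) fy ex_all fx.
split=> //=.
- move=> x y /fix_sim fx /fix_sim fy.
  by rewrite -(simK TG (meet x y)) (simI TG); apply/fix_sim/fix_join.
- by move=> x y fx fy; rewrite -{1}fx -{1}fy (MGsim_M3 TM) all_all fx fy.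
Qed.

Hypothesis TG : is_Gsim join meet imp sim bot top.

(** The value at [x] is the join of the finitely many members of [C] below [x], with [bot] as the
    empty join. *)
Lemma finite_interior (C : set T) : finite_set C ->
  Gsim_subuniverse join meet imp sim bot top C -> exists q, is_interior C q.
Proof.
move=> /(@finite_seqP {classic T})[s eC] CU.
suff /choice[q Cq] : forall x, exists c,
    [/\ C c, c <= x & forall d, C d -> d <= x -> d <= c] by exists q.
(* Generalized for the induction: [c] stays in [C], but is compared only with the listed members. *)
move=> x; suff: [set` s] `<=` C -> exists c,
    [/\ C c, c <= x & forall d, [set` s] d -> d <= x -> d <= c].
  by rewrite -eC; apply.
elim: s {eC} => [|d s IHs] sC.
  exists bot; split=> //; [exact: sub_bot CU | exact: le0x TG x].
have [|c [Cc cx cmax]] := IHs.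
  by move=> e se; apply: sC; rewrite /= in_cons [e \in s]se orbT.
have Cd : C d by apply: sC; exact: mem_head.
have [dx|ndx] := pselect (d <= x); last first.
  exists c; split=> // e; rewrite /= in_cons => /orP[/eqP-> //|]; exact: cmax.
exists (join d c); split; [exact: (sub_join CU Cd Cc) | exact: (leUx TG) |].
move=> e; rewrite /= in_cons => /orP[/eqP-> _|se ex_le]; first exact: (leUl TG).
by apply: (le_trans TG (cmax e se ex_le)); exact: (leUr TG).
Qed.

(* The coimplication [~ (~ c -> ~ d)] is the least [z] with [d <= c \/ z], and
   lies in [C] together with [c] and [d]: hence (M4), whatever [C] is. *)
Lemma interior_MGsim (C : set T) (q : T -> T) :
  Gsim_subuniverse join meet imp sim bot top C -> is_interior C q ->
  is_MGsim join meet imp sim (fun x => sim (q (sim x))) q bot top.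
Proof.
move=> CU Cq; pose p x := sim (q (sim x)).
have qC x : C (q x) by have [] := Cq x.
have q_le x : q x <= x by have [] := Cq x.
have q_max c x : C c -> c <= x -> c <= q x by have [] := Cq x; auto.
have pC x : C (p x) by apply: sub_sim CU _ _.
have p_ge x : x <= p x by have := sim_le TG (q_le (sim x)); rewrite (simK TG).
have p_min c x : C c -> x <= c -> p x <= c.
  move=> Cc /(sim_le TG)/(q_max _ _ (sub_sim CU Cc))/(sim_le TG).
  by rewrite (simK TG).
have meetC := meetC (heyting_lattice (godel_heyting (Gsim_godel TG))).
split=> //.
- by move=> x; apply/(impE1 TG).
- move=> x y; apply: (le_anti TG).
    (* The claim becomes p x <= q (x -> q y) -> q y; the right side is in [C], so [p_min] replaces p
       x by x. *)
    apply: (imp_intro TG); rewrite meetC; apply: (imp_elim TG); apply: (p_min).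
      exact: (sub_imp CU (qC _) (qC _)).
    by apply: (imp_intro TG); rewrite meetC; apply: (imp_elim TG).
  apply: (q_max); first exact: (sub_imp CU (pC x) (qC y)).
  apply: (imp_intro TG); apply: (le_trans TG _ (mp TG (p x) (q y))).
  exact: leI2 TG _ _ _ _ (le_refl TG _) (p_ge x).
- move=> x y; apply: (le_anti TG).
    apply: (imp_intro TG); apply: (q_max); last exact: (imp_elim TG).
    exact: (sub_meet CU (qC _) (qC _)).
  apply: (q_max); first exact: (sub_imp CU (qC _) (qC _)).
  by apply: (imp_intro TG); apply: (le_trans TG _ (q_le y)); apply: mp TG _ _.
- move=> x y; set c := sim _; have Cc : C c by exact: pC.
  apply: (le_anti TG); last first.
    apply: (q_max); first exact: (sub_join CU Cc (qC _)).
    exact: leU2 TG _ _ _ _ (le_refl TG _) (q_le y).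
  set d := q _; have Cd : C d by exact: qC.
  have : d <= join c y by exact: q_le.
  move=> /(sim_le TG); rewrite (simU TG) meetC => /(imp_intro TG)/(sim_le TG).
  have Ci := sub_sim CU (sub_imp CU (sub_sim CU Cc) (sub_sim CU Cd)).
  rewrite (simK TG) => /(q_max _ _ Ci)/(sim_le TG).
  rewrite (simK TG) => /(imp_elim TG); rewrite meetC -(simU TG).
  by move=> /(sim_le TG); rewrite !(simK TG).
- by move=> x; rewrite !(simK TG).
Qed.

End Quantifiers.

(** * Passage to a subalgebra and the embedding *)

(** An injective homomorphism reflects identities, and also residuation, because the order is
    defined by an equation. *)
Lemma MGsim_inj (S T : Type) (h : S -> T)
    (sjoin smeet simp : S -> S -> S) (ssim sex sall : S -> S) (sbot stop : S)
    (join meet imp : T -> T -> T) (sim ex all : T -> T) (bot top : T) :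
  injective h ->
  {morph h : x y / sjoin x y >-> join x y} ->
  {morph h : x y / smeet x y >-> meet x y} ->
  {morph h : x y / simp x y >-> imp x y} ->
  {morph h : x / ssim x >-> sim x} ->
  {morph h : x / sex x >-> ex x} ->
  {morph h : x / sall x >-> all x} ->
  h sbot = bot -> h stop = top ->
  is_MGsim join meet imp sim ex all bot top ->
  is_MGsim sjoin smeet simp ssim sex sall sbot stop.
Proof.
move=> hI hj hm hi hs he ha h0 h1 TM.
have TG := MGsim_Gsim TM; have TDM := Gsim_de_morgan TG.
have TH := godel_heyting (Gsim_godel TG); have TL := heyting_lattice TH.
pose hE := (hj, hm, hi, hs, he, ha, h0, h1).
have hle x y : lattice_le smeet x y <-> lattice_le meet (h x) (h y).
  by rewrite /lattice_le -hm; split=> [->|/hI].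
have SL : is_bounded_lattice sjoin smeet sbot stop.
  split=> [x y z|x y|x y z|x y|x y|x y|x|x]; apply: hI; rewrite !hE.
  - exact: joinA TL _ _ _.
  - exact: joinC TL _ _.
  - exact: meetA TL _ _ _.
  - exact: meetC TL _ _.
  - exact: join_meet_absorb TL _ _.
  - exact: meet_join_absorb TL _ _.
  - exact: join_bot TL _.
  - exact: meet_top TL _.
split; last 5 first.
- by move=> x; apply: hI; rewrite !hE; apply: MGsim_M1 TM _.
- by move=> x y; apply: hI; rewrite !hE; apply: MGsim_M2 TM _ _.
- by move=> x y; apply: hI; rewrite !hE; apply: MGsim_M3 TM _ _.
- by move=> x y; apply: hI; rewrite !hE; apply: MGsim_M4 TM _ _.
- by move=> x; apply: hI; rewrite !hE; apply: MGsim_Q TM _.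
split; last by move=> x; apply/hle; rewrite !hE; apply: Gsim_neg_le TG _.
- split; last first.
    by move=> x y; apply: hI; rewrite !hE; apply: (prelinear TG).
  split=> // x y z; rewrite !hle !hE; exact: heyting_residuation TH _ _ _.
- split=> // [x y z|x|x y]; apply: hI; rewrite !hE.
  + exact: de_morgan_distr TDM _ _ _.
  + exact: simK TG _.
  + exact: simI TG _ _.
Qed.

Definition MG_algebra (T : Type) (join meet imp : T -> T -> T)
    (sim ex all : T -> T) (bot top : T) : algebra MG_signature :=
  @Algebra MG_signature T (fun f =>
    match f return (MG_arity f).-tuple T -> T with
    | Join => fun a => join (thead a) (thead (behead_tuple a))
    | Meet => fun a => meet (thead a) (thead (behead_tuple a))
    | Imp => fun a => imp (thead a) (thead (behead_tuple a))
    | Sim => fun a => sim (thead a)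
    | Exists => fun a => ex (thead a)
    | Forall => fun a => all (thead a)
    | Bot => fun=> bot
    | Top => fun=> top
    end).

Theorem theorem3p4 : FEP MGsim.
Proof.
move=> A MA N finN; rewrite /MGsim /= in MA.
set join := fun x y => interp A Join [tuple x; y] in MA.
set meet := fun x y => interp A Meet [tuple x; y] in MA.
set imp := fun x y => interp A Imp [tuple x; y] in MA.
set sim := fun x => interp A Sim [tuple x] in MA.
set ex := fun x => interp A Exists [tuple x] in MA.
set all := fun x => interp A Forall [tuple x] in MA.
set bot := interp A Bot [tuple] in MA.
set top := interp A Top [tuple] in MA.
have TG := MGsim_Gsim MA; have FU := fixed_subuniverse MA.
have [U [finU NU UU]] := Gsim_locally_finite TG finN.
pose C := U `&` [set x | all x = x].
have CU : Gsim_subuniverse join meet imp sim bot top C.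
  case: UU FU => ? ? Uj Um Ui Us [? ? Fj Fm Fi Fs].
  by split=> // [x y|x y|x y|x] [Ux Fx]; [case=> Uy Fy..|]; split; auto.
have [q Cq] := finite_interior TG (finite_setIl _ finU) CU.
have qM := interior_MGsim TG CU Cq.
have Uq x : U (q x) by have [[]] := Cq x.
(* If all x is in [U], it is in [C] and so below q x; conversely q x is a fixed point of [all] below
   x, hence below all x. *)
have q_all x : U (all x) -> q x = all x.
  move=> Uax; have [Fax ax_le ax_max] := all_interior MA x.
  have [[_ Fqx] qx_le qx_max] := Cq x.
  by apply: (le_anti TG); [exact: ax_max | exact: qx_max].
have q_ex x : U (ex x) -> sim (q (sim x)) = ex x.
  (* By (Q), all (~x) = ~ ex x, which lies in [U] with ex x, so [q_all] applies at ~x. *)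
  move=> Uex; have aE : all (sim x) = sim (ex x).
    by rewrite (MGsim_Q MA) (simK TG).
  rewrite q_all ?aE ?(simK TG) //; exact: (sub_sim UU).
pose lift2 (op : A -> A -> A) (opU : forall x y, U x -> U y -> U (op x y))
  (x y : U) : U := exist _ (op (val x) (val y))
     (mem_set (opU _ _ (set_mem (valP x)) (set_mem (valP y)))).
pose lift1 (op : A -> A) (opU : forall x, U x -> U (op x)) (x : U) : U :=
  exist _ (op (val x)) (mem_set (opU _ (set_mem (valP x)))).
pose B := MG_algebra (lift2 join (sub_join UU)) (lift2 meet (sub_meet UU))
  (lift2 imp (sub_imp UU)) (lift1 sim (sub_sim UU))
  (lift1 _ (fun x _ => sub_sim UU (Uq (sim x))))
  (lift1 q (fun x _ => Uq x))
  (exist _ bot (mem_set (sub_bot UU)) : U)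
  (exist _ top (mem_set (sub_top UU)) : U).
exists B; split.
(* [qM] concerns all of [A] with the new quantifiers; [B] is its subalgebra on [U]. *)
- by apply: (@MGsim_inj U A val) qM => //; exact: val_inj.
- have valI : {in val @^-1` U &, injective (val : U -> A)}.
    by move=> x y _ _; exact: val_inj.
  apply: sub_finite_set (finite_preimage valI finU) => x _.
  exact: set_mem (valP x).
pose iota (x : N) : B :=
  exist _ (val x) (mem_set (NU _ (set_mem (valP x)))) : U.
exists iota; split=> [x y /(congr1 val) xy|]; first exact: val_inj.
case=> /= a b.
- case/tupleP: a => x a; case/tupleP: a => y a; rewrite (tuple0 a) => ab.
  apply: val_inj; apply: etrans (esym ab) _.
  by congr (interp A Join _); apply: val_inj.
- case/tupleP: a => x a; case/tupleP: a => y a; rewrite (tuple0 a) => ab.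
  apply: val_inj; apply: etrans (esym ab) _.
  by congr (interp A Meet _); apply: val_inj.
- case/tupleP: a => x a; case/tupleP: a => y a; rewrite (tuple0 a) => ab.
  apply: val_inj; apply: etrans (esym ab) _.
  by congr (interp A Imp _); apply: val_inj.
- case/tupleP: a => x a; rewrite (tuple0 a) => ab.
  apply: val_inj; apply: etrans (esym ab) _.
  by congr (interp A Sim _); apply: val_inj.
- case/tupleP: a => x a; rewrite (tuple0 a) => ab.
  have {}ab : ex (val x) = val b.
    by apply: etrans _ ab; congr (interp A Exists _); apply: val_inj.
  apply: val_inj; apply: etrans (esym ab) _.
  (* The value is in [N], hence in [U], where the old and new quantifiers agree. *)
  by symmetry; apply: q_ex; rewrite ab; apply: (NU); exact: set_mem (valP b).
- case/tupleP: a => x a; rewrite (tuple0 a) => ab.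
  have {}ab : all (val x) = val b.
    by apply: etrans _ ab; congr (interp A Forall _); apply: val_inj.
  apply: val_inj; apply: etrans (esym ab) _.
  by symmetry; apply: q_all; rewrite ab; apply: (NU); exact: set_mem (valP b).
- move=> ab; apply: val_inj; apply: etrans (esym ab) _.
  by congr (interp A Bot _); apply: val_inj; rewrite !tuple0.
- move=> ab; apply: val_inj; apply: etrans (esym ab) _.
  by congr (interp A Top _); apply: val_inj; rewrite !tuple0.
Qed.
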